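(* Let $0<q<1$. For all $x,t\in\mathbb{C}$, $$(xt,-t;q)_\infty=\sum_{n=0}^\infty q^{\binom n2}t^nS_n(xq^{-n};q).$$
   Context: Notation: $(c;q)_n=\prod_{j=0}^{n-1}(1-cq^j)$, $(c;q)_\infty=\prod_{j\ge0}(1-cq^j)$, $(c_1,c_2;q)_\infty=(c_1;q)_\infty(c_2;q)_\infty$, $\genfrac{[}{]}{0pt}{}{n}{k}_q=\frac{(q;q)_n}{(q;q)_k(q;q)_{n-k}}$. The Stieltjes–Wigert polynomials are $S_n(x;q)=\frac{1}{(q;q)_n}\sum_{k=0}^n\genfrac{[}{]}{0pt}{}{n}{k}_q q^{k^2}(-x)^k$. *)

(* Defs.v *)
From mathcomp Require Export all_boot all_order all_algebra complex.
From mathcomp Require Export all_classical all_reals all_analysis.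
Export numFieldNormedType.Exports.

Set Implicit Arguments.
Unset Strict Implicit.
Unset Printing Implicit Defensive.

Import Order.TTheory GRing.Theory Num.Theory.

Local Open Scope classical_set_scope.
Local Open Scope ring_scope.

Definition qpoch (K : numFieldType) (c q : K) (n : nat) : K :=
  \prod_(j < n) (1 - c * q ^+ j).

(* The infinite product is the limit of its partial products; [lim] is a total
   operator, and the limit exists for every [c] when [`|q| < 1] and [K] is
   complete, as for [K = R[i]] below. *)
Definition qpoch_inf (K : numFieldType) (c q : K) : K :=
  lim (qpoch c q n @[n --> \oo]).

Definition qpoch_inf2 (K : numFieldType) (c1 c2 q : K) : K :=
  qpoch_inf c1 q * qpoch_inf c2 q.

(* Only meaningful for [k <= n]. *)
Definition qbinom (K : numFieldType) (q : K) (n k : nat) : K :=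
  qpoch q q n / (qpoch q q k * qpoch q q (n - k)).

Definition stieltjes_wigert (K : numFieldType) (n : nat) (x q : K) : K :=
  (qpoch q q n)^-1 *
    \sum_(0 <= k < n.+1) qbinom q n k * q ^+ (k ^ 2) * (- x) ^+ k.

(* Main.v *)
Require Import Defs.
From mathcomp Require Import ring zify.

Set Implicit Arguments.
Unset Strict Implicit.
Unset Printing Implicit Defensive.

Import Order.TTheory GRing.Theory Num.Theory.
Local Open Scope classical_set_scope.
Local Open Scope ring_scope.
Local Open Scope complex_scope.

(** Put [e_n(c) = q^(n(n-1)/2) (-c)^n / (q;q)_n] ([euler_term]). Since
    [(k+m choose 2) = (k choose 2) + (m choose 2) + k m], the factor
    [q^(k^2) (q^-n)^k] in the [k]-th term of [S_n(x q^-n; q)] turns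
    [q^(n choose 2)] into [q^(k choose 2) q^(n-k choose 2)]; hence the [n]-th
    term of the series is the convolution
    [\sum_(k <= n) e_k(x t) e_(n-k)(- t)] ([stieltjes_wigert_term]), and the
    series is the Cauchy product of the two absolutely convergent series
    [\sum_n e_n(x t)] and [\sum_n e_n(- t)] ([cauchy_product_cvg]).

    It remains to see Euler's identity [\sum_n e_n(c) = (c;q)_oo]
    ([euler_product]). The sum [e(c)] satisfies [e(c) = (1 - c) e(c q)]
    ([euler_sum_rec]), so [e(c) = (c;q)_n e(c q^n)] for every [n], and
    [e(c q^n)] tends to [e(0) = 1] ([euler_sum_cvg1]). This also proves that the
    infinite product converges.

    All of this holds over any [numFieldType] in which [q^n] tends to 0 and the
    Euler series converge ([generating_function_of_summable]). For [R[i]], the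
    norm of [e_n(c)] is the real Euler term [e_n(-|c|)], summable by the ratio
    test ([is_cvg_euler_real]), and comparison is applied to real and imaginary
    parts ([is_cvg_series_complex]). *)

(** * Limits in a numFieldType *)

Lemma cvg_of_dist_le (K : numFieldType) (f g : nat -> K) (l : K) :
  (forall n, `|l - f n| <= g n) -> g @ \oo --> (0 : K) -> f @ \oo --> l.
Proof.
move=> fg /cvgrPdist_le g0; apply/cvgrPdist_le => e /g0; apply: filterS => n.
rewrite sub0r normrN; apply: le_trans; apply: le_trans (fg n) _.
by apply/real_ler_norm/ger0_real; apply: le_trans (fg n).
Qed.

(** Closedness of balls, from the triangle inequality because the order of [K]
    need not be total. *)
Lemma lim_dist_le (K : numFieldType) (f : nat -> K) (l a d : K) :
  f @ \oo --> l -> (\forall n \near \oo, `|a - f n| <= d) -> `|a - l| <= d.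
Proof.
move=> /cvgrPdist_le fl fd; apply/ler_addgt0Pr => e e0.
have [n [/= dn en]] : exists n, `|a - f n| <= d /\ `|l - f n| <= e.
  near \oo => n; exists n; split; near: n => //.
  exact: fl.
rewrite -(subrKA (f n)); apply: le_trans (ler_normD _ _) _.
by apply: lerD => //; rewrite distrC.
Unshelve. all: by end_near. Qed.

(** * Cauchy products *)

Lemma series_cauchy_product (K : numFieldType) (a b : nat -> K) (N : nat) :
  series (fun n => \sum_(0 <= k < n.+1) a k * b (n - k)%N) N =
  \sum_(0 <= i < N) a i * series b (N - i)%N.
Proof.
rewrite /series /=; elim: N => [|N IH]; first by rewrite !big_geq.
rewrite big_nat_recr //= IH.
have -> : \sum_(0 <= i < N) a i * \sum_(0 <= k < N - i) b k =
    \sum_(0 <= i < N.+1) a i * \sum_(0 <= k < N - i) b k.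
  by rewrite [RHS]big_nat_recr //= subnn (big_geq (leqnn 0)) mulr0 addr0.
rewrite -big_split /=; apply: eq_big_nat => i /andP[_ iN].
by rewrite subSn// big_nat_recr //= mulrDr.
Qed.

(** The square [i, j < N] minus the triangle [i + j < N] carries the error, and
    the triangle contains the square [i, j < N./2]. Both sides are instances of
    the same formula [diff], once for [a, b] and once for their norms. *)
Lemma cauchy_product_dist (K : numFieldType) (a b : nat -> K) (N : nat) :
  `|series a N * series b N -
    series (fun n => \sum_(0 <= k < n.+1) a k * b (n - k)%N) N| <=
  series (fun n => `|a n|) N * series (fun n => `|b n|) N -
  series (fun n => `|a n|) N./2 * series (fun n => `|b n|) N./2.
Proof.
have diff (u v : nat -> K) : series u N * series v N -
    \sum_(0 <= i < N) u i * series v (N - i)%N =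
    \sum_(0 <= i < N) u i * \sum_(N - i <= j < N) v j.
  rewrite {1}/series /= mulr_suml -sumrB; apply: eq_big_nat => i _.
  by rewrite -mulrBr sub_series_geq ?leq_subr.
rewrite series_cauchy_product diff.
have half_le : series (fun n => `|a n|) N./2 * series (fun n => `|b n|) N./2 <=
    \sum_(0 <= i < N) `|a i| * series (fun n => `|b n|) (N - i)%N.
  rewrite {1}/series /= mulr_suml [leRHS](big_cat_nat (n := N./2)) //=; last lia.
  rewrite -[leLHS]addr0; apply: lerD; last first.
    by apply: sumr_ge0 => i _; rewrite mulr_ge0 // sumr_ge0.
  apply: ler_sum_nat => i /andP[_ iN]; rewrite ler_wpM2l//.
  rewrite -subr_ge0 sub_series_geq; last by move: iN; lia.
  by rewrite sumr_ge0.
apply: le_trans (lerB (lexx _) half_le); rewrite diff.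
apply: le_trans (ler_norm_sum _ _ _) _; apply: ler_sum => i _.
by rewrite normrM ler_wpM2l// ler_norm_sum.
Qed.

Lemma cvg_half : half @ \oo --> \oo.
Proof. by move=> A [N _ NA]; exists N.*2 => // n /= Nn; apply: NA => /=; lia. Qed.

(** The error bound of [cauchy_product_dist] is the difference between a
    convergent sequence and a subsequence of it. *)
Lemma cauchy_product_cvg (K : numFieldType) (a b : nat -> K) :
  cvgn (series a) -> cvgn (series b) ->
  cvgn (series (fun n => `|a n|)) -> cvgn (series (fun n => `|b n|)) ->
  series (fun n => \sum_(0 <= k < n.+1) a k * b (n - k)%N) @ \oo -->
  limn (series a) * limn (series b).
Proof.
move=> ca cb cna cnb.
set c := series (fun n => \sum_(_ <= _ < _) _).
set An := series (fun n => `|a n|); set Bn := series (fun n => `|b n|).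
have cab : An \* Bn @ \oo --> limn An * limn Bn by exact: cvgM.
have d0 : series a \* series b - c @ \oo --> (0 : K).
  apply: (@cvg_of_dist_le _ _ (fun N => An N * Bn N - An N./2 * Bn N./2)).
    by move=> n; rewrite sub0r normrN; exact: cauchy_product_dist.
  rewrite -(subrr (limn An * limn Bn)); apply: cvgB => //.
  exact: (cvg_comp _ _ cvg_half cab).
rewrite -[c](subKr (series a \* series b)) -[X in _ --> X]subr0.
by apply: cvgB => //; exact: cvgM.
Qed.

(** * Euler's series for the infinite product *)

Lemma qpochS (K : numFieldType) (c q : K) n :
  qpoch c q n.+1 = qpoch c q n * (1 - c * q ^+ n).
Proof. by rewrite /qpoch big_ord_recr. Qed.

Lemma qpoch_gt0 (K : numFieldType) (q : K) n :
  0 < q -> q < 1 -> 0 < qpoch q q n.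
Proof.
move=> q0 q1; apply: prodr_gt0 => j _; rewrite subr_gt0 -exprS.
by rewrite exprn_ilt1 // ltW.
Qed.

Definition euler_term (K : numFieldType) (c q : K) (n : nat) : K :=
  q ^+ 'C(n, 2) * (- c) ^+ n / qpoch q q n.

Definition euler_sum (K : numFieldType) (c q : K) : K :=
  limn (series (euler_term c q)).

Lemma euler_term0 (K : numFieldType) (c q : K) : euler_term c q 0 = 1.
Proof. by rewrite /euler_term bin0n !expr0 /qpoch big_ord0 invr1 !mulr1. Qed.

Lemma euler_termS (K : numFieldType) (c q : K) n : 0 < q -> q < 1 ->
  euler_term c q n.+1 * (1 - q ^+ n.+1) = - c * q ^+ n * euler_term c q n.
Proof.
move=> q0 q1; rewrite /euler_term qpochS -exprS binS bin1 exprD exprS.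
have /lt0r_neq0 := qpoch_gt0 n q0 q1; have /lt0r_neq0 := qpoch_gt0 n.+1 q0 q1.
rewrite qpochS -exprS mulf_eq0 negb_or => /andP[_ q2] q3.
by field; rewrite q2 q3.
Qed.

Lemma euler_termM (K : numFieldType) (c d q : K) n :
  euler_term (c * d) q n = d ^+ n * euler_term c q n.
Proof. by rewrite /euler_term -mulNr exprMn; ring. Qed.

(** Makes absolute convergence of an Euler series the convergence of another
    Euler series. *)
Lemma norm_euler_term (K : numFieldType) (c q : K) n : 0 < q -> q < 1 ->
  `|euler_term c q n| = euler_term (- `|c|) q n.
Proof.
move=> q0 q1; rewrite /euler_term opprK !normrM normfV !normrX normrN.
by rewrite (gtr0_norm q0) (gtr0_norm (qpoch_gt0 n q0 q1)).
Qed.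

(** The finite form of [e(c) = (1 - c) e(c q)]: with [e_n(c q) = q^n e_n(c)],
    the recurrence [euler_termS] reads
    [e_(n+1)(c) - e_(n+1)(c q) = - c e_n(c q)]. *)
Lemma euler_partial_sum (K : numFieldType) (c q : K) N : 0 < q -> q < 1 ->
  series (euler_term c q) N.+1 =
  series (euler_term (c * q) q) N.+1 - c * series (euler_term (c * q) q) N.
Proof.
move=> q0 q1; rewrite /series /= !big_nat_recl //= !euler_term0 -addrA.
congr (_ + _); rewrite mulr_sumr -sumrB; apply: eq_big_nat => i _.
rewrite !euler_termM; have := euler_termS c i q0 q1.
by rewrite mulrBr mulr1 => /eqP; rewrite subr_eq => /eqP {1}->; ring.
Qed.

Lemma euler_sum_rec (K : numFieldType) (c q : K) : 0 < q -> q < 1 ->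
  (forall c, cvgn (series (euler_term c q))) ->
  euler_sum c q = (1 - c) * euler_sum (c * q) q.
Proof.
move=> q0 q1 cv; apply/cvg_lim => //; rewrite -cvg_shiftS.
rewrite mulrBl mul1r.
have -> : [sequence series (euler_term c q) n.+1]_n =
    [sequence series (euler_term (c * q) q) n.+1]_n -
    (fun n => c * series (euler_term (c * q) q) n).
  by apply/funext => n /=; rewrite euler_partial_sum.
apply: cvgB; first by rewrite cvg_shiftS; exact: cv.
by apply: cvgMl_tmp; exact: cv.
Qed.

(** As [e_k(c q^n) = q^(n k) e_k(c)], all terms but the constant one gain a
    factor at most [q^n]; so [|1 - e(c q^n)| <= q^n B] for any bound [B] on the
    partial sums of the norms. *)
Lemma euler_sum_cvg1 (K : numFieldType) (c q : K) : 0 < q -> q < 1 ->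
  (fun n => q ^+ n) @ \oo --> (0 : K) ->
  (forall c, cvgn (series (euler_term c q))) ->
  euler_sum (c * q ^+ n) q @[n --> \oo] --> (1 : K).
Proof.
move=> q0 q1 qn0 cv.
pose A := series (euler_term (- `|c|) q); pose B := `|limn A| + 1.
apply: (@cvg_of_dist_le _ _ (fun n => q ^+ n * B)); last first.
  by rewrite -(mul0r B); exact: cvgMr_tmp.
move=> n; apply: lim_dist_le; first exact: cv.
have : \forall N \near \oo, `|A N| < B.
  by apply: cvgr_norm_lt; [exact: cv|rewrite ltrDl].
move=> [N0 _ AB]; exists N0.+1 => // -[//|N] /= N0N.
have {AB N0N} /ltW AB : `|A N.+1| < B by apply: AB => /=; lia.
have qn : 0 <= q ^+ n by rewrite exprn_ge0 // ltW.
apply: le_trans (ler_wpM2l qn AB).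
have -> : A N.+1 = 1 + \sum_(0 <= k < N) `|euler_term c q k.+1|.
  rewrite /A /series /= big_nat_recl //= euler_term0; congr (_ + _).
  by apply: eq_bigr => k _; rewrite norm_euler_term.
rewrite [in leRHS]ger0_norm ?addr_ge0 ?sumr_ge0 //.
apply: (@le_trans _ _ (q ^+ n * \sum_(0 <= k < N) `|euler_term c q k.+1|));
  last first.
  by rewrite ler_wpM2l // lerDr.
rewrite /series /= big_nat_recl //= euler_term0 opprD addNKr normrN mulr_sumr.
apply: le_trans (ler_norm_sum _ _ _) _; apply: ler_sum => k _.
rewrite euler_termM normrM ler_wpM2r // normrX ger0_norm // exprS.
by rewrite ler_piMr // exprn_ile1 // exprn_ile1 // ltW.
Qed.

(** In [e(c) = (c;q)_n e(c q^n)] the last factor tends to 1, so it can be divided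
    out for large [n]. *)
Lemma euler_product (K : numFieldType) (c q : K) : 0 < q -> q < 1 ->
  (fun n => q ^+ n) @ \oo --> (0 : K) ->
  (forall c, cvgn (series (euler_term c q))) ->
  qpoch c q @ \oo --> euler_sum c q.
Proof.
move=> q0 q1 qn0 cv.
have prod_sum n : qpoch c q n * euler_sum (c * q ^+ n) q = euler_sum c q.
  elim: n => [|n <-]; first by rewrite /qpoch big_ord0 mul1r expr0 mulr1.
  by rewrite [in RHS](euler_sum_rec (c * _)) // qpochS exprSr !mulrA.
have s1 := euler_sum_cvg1 c q0 q1 qn0 cv.
have : euler_sum c q * (euler_sum (c * q ^+ n) q)^-1 @[n --> \oo] -->
    euler_sum c q.
  rewrite -[X in _ --> X]mulr1 -[X in _ * X]invr1.
  by apply: cvgMl_tmp; apply: cvgV => //; exact: oner_neq0.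
apply: cvg_trans; apply: near_eq_cvg.
near=> n; rewrite -(prod_sum n) mulfK //; near: n.
by apply: cvgr_neq0 s1 _; exact: oner_neq0.
Unshelve. all: by end_near. Qed.

(** * The series as a Cauchy product *)

Lemma bin2D k m : ('C(k + m, 2) = 'C(k, 2) + 'C(m, 2) + k * m)%N.
Proof.
elim: k => [|k IH]; first by rewrite bin0n mul0n addn0 add0n.
by rewrite addSn !binS !bin1 IH; lia.
Qed.

Lemma stieltjes_wigert_term (K : numFieldType) (x t q : K) n :
  0 < q -> q < 1 ->
  q ^+ 'C(n, 2) * t ^+ n * stieltjes_wigert n (x * q ^- n) q =
  \sum_(0 <= k < n.+1) euler_term (x * t) q k * euler_term (- t) q (n - k)%N.
Proof.
move=> q0 q1; rewrite /stieltjes_wigert !mulr_sumr.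
apply: eq_big_nat => k /andP[_]; rewrite ltnS => kn.
have [m ->] : exists m, n = (k + m)%N by exists (n - k)%N; lia.
rewrite /euler_term /qbinom addKn bin2D opprK.
have qm i : qpoch q q i != 0 by exact/lt0r_neq0/qpoch_gt0.
have qk : q ^+ (k ^ 2) * q ^+ (k * m) = (q ^+ (k + m)) ^+ k.
  by rewrite -exprD -exprM; congr (_ ^+ _); lia.
have qkm : q ^+ (k + m) != 0 by rewrite expf_neq0 // gt_eqF.
have {}qk : q ^+ (k ^ 2) * q ^+ (k * m) * (- (x * q ^- (k + m))) ^+ k = (- x) ^+ k.
  by rewrite qk -exprMn mulrN mulrCA divff// mulr1.
rewrite -[- (x * t)]mulNr exprMn -qk !exprD.
have := qm k; have := qm m; have := qm (k + m)%N.
move: ((- _) ^+ k) (qpoch q q k) (qpoch q q m) (qpoch q q (k + m)) => y a b c a0 b0 c0.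
by field; rewrite a0 b0 c0.
Qed.

Lemma generating_function_of_summable (K : numFieldType) (x t q : K) :
  0 < q -> q < 1 ->
  (fun n => q ^+ n) @ \oo --> (0 : K) ->
  (forall c, cvgn (series (euler_term c q))) ->
  series (fun n => q ^+ 'C(n, 2) * t ^+ n * stieltjes_wigert n (x * q ^- n) q)
    @ \oo --> qpoch_inf2 (x * t) (- t) q.
Proof.
move=> q0 q1 qn0 cv.
have ncv c : cvgn (series (fun n => `|euler_term c q n|)).
  by under eq_fun do rewrite norm_euler_term //; exact: cv.
have infE c : qpoch_inf c q = euler_sum c q.
  by apply/cvg_lim => //; exact: euler_product.
under eq_fun do rewrite stieltjes_wigert_term //.
by rewrite /qpoch_inf2 !infE; exact: cauchy_product_cvg.
Qed.

(** * Convergence of Euler series in R[i] *)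

Lemma ratio_test (R : realType) (u r : nat -> R) :
  (forall n, 0 <= u n) -> (forall n, u n.+1 <= r n * u n) ->
  r @ \oo --> (0 : R) -> cvgn (series u).
Proof.
move=> u0 ur r0.
have [N rN] : exists N, forall n, (N <= n)%N -> r n <= 2^-1.
  have h0 : 0 < (2^-1 : R) by rewrite invr_gt0.
  have /cvgrPdist_le /(_ _ h0) [N _ NP] := r0; exists N => n Nn.
  by apply: le_trans (NP n Nn); rewrite sub0r normrN ler_norm.
(* The sum bounds each [u n * 2 ^+ n] with [n <= N], where no ratio is known. *)
pose C := \sum_(0 <= k < N.+1) u k * 2 ^+ k.
have C0 : 0 <= C by apply: sumr_ge0 => i _; rewrite mulr_ge0 // exprn_ge0.
have uC n : u n <= geometric C 2^-1 n.
  elim: n => [|n IH] /=.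
    rewrite expr0 mulr1 /C big_nat_recl //= expr0 mulr1 lerDl.
    by apply: sumr_ge0 => i _; rewrite mulr_ge0 // exprn_ge0.
  have [nN|Nn] := ltnP n N; last first.
    apply: le_trans (ur n) _; rewrite exprS mulrCA.
    apply: le_trans (ler_wpM2r (u0 n) (rN n Nn)) _.
    by rewrite ler_wpM2l // invr_ge0.
  rewrite exprVn ler_pdivlMr ?exprn_gt0 // /C.
  rewrite big_mkord (bigD1 (Ordinal (nN : n.+1 < N.+1)%N)) //= lerDl.
  by apply: sumr_ge0 => i _; rewrite mulr_ge0 // exprn_ge0.
apply: series_le_cvg uC _ => //.
  by move=> n; rewrite geometric_ge0 // invr_ge0.
by apply: is_cvg_geometric_series; rewrite ger0_norm ?invf_lt1 ?invr_ge0 ?ltr1n.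
Qed.

(** The argument is [- c] with [0 <= c] so that all terms are nonnegative; the
    ratio of consecutive terms is [c q^n / (1 - q^(n+1)) <= c q^n / (1 - q)]. *)
Lemma is_cvg_euler_real (R : realType) (c q : R) : 0 < q -> q < 1 -> 0 <= c ->
  cvgn (series (euler_term (- c) q)).
Proof.
move=> q0 q1 c0.
have term_ge0 n : 0 <= euler_term (- c) q n.
  by rewrite -[c]ger0_norm // -norm_euler_term.
apply: (@ratio_test _ _ (fun n => c / (1 - q) * q ^+ n)) => //.
  move=> n.
  have d0 : 0 < 1 - q ^+ n.+1 by rewrite subr_gt0 exprn_ilt1 // ltW.
  rewrite -(ler_pM2r d0) euler_termS // opprK.
  have -> : c / (1 - q) * q ^+ n * euler_term (- c) q n * (1 - q ^+ n.+1) =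
      c * q ^+ n * euler_term (- c) q n * ((1 - q ^+ n.+1) / (1 - q)) by ring.
  apply: ler_peMr; first by rewrite mulr_ge0 ?term_ge0 // mulr_ge0 // exprn_ge0 // ltW.
  rewrite ler_pdivlMr ?subr_gt0 // mul1r lerD2l lerN2 exprS.
  by rewrite ler_piMr ?(ltW q0) // exprn_ile1 // ltW.
rewrite -(mulr0 (c / (1 - q))); apply: cvgMl_tmp; apply: cvg_expr.
by rewrite gtr0_norm.
Qed.

Lemma cvg_real_complex (R : realType) (f : nat -> R) (l : R) :
  f @ \oo --> l ->
  (fun n => (f n)%:C : (R[i] : numFieldType)) @ \oo -->
  (l%:C : (R[i] : numFieldType)).
Proof.
move=> /cvgrPdist_le fl; apply/cvgrPdist_le => e e0.
have eR : e = (complex.Re e)%:C by rewrite RRe_real // gtr0_real.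
move: e0; rewrite eR ltcR => /fl; apply: filterS => n.
by rewrite -rmorphB normc_def /= expr0n addr0 sqrtr_sqr lecR.
Qed.

(** Both the real and the imaginary part of [u n] are bounded by [b n], so this
    is comparison of real series. *)
Lemma is_cvg_series_complex (R : realType) (u : nat -> R[i]) (b : nat -> R) :
  (forall n, `|u n| <= (b n)%:C) -> cvgn (series b) ->
  cvgn (series u : nat -> (R[i] : numFieldType)).
Proof.
move=> ub cb.
have part (p : nat -> R) : (forall n, `|p n| <= b n) -> cvgn (series p).
  move=> pb; apply: normed_cvg; apply: series_le_cvg cb => // n.
    exact: normr_ge0.
  by apply: le_trans (pb n).
have cRe : cvgn (series (fun n => complex.Re (u n))).
  by apply: part => n; rewrite -lecR; apply: le_trans (ub n); exact: normc_ge_Re.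
have cIm : cvgn (series (fun n => complex.Im (u n))).
  apply: part => n; rewrite -lecR; apply: le_trans (ub n).
  by case: (u n) => x y; simpc; rewrite -sqrtr_sqr ler_wsqrtr // lerDr sqr_ge0.
apply/cvg_ex; eexists.
have -> : series u = (fun n => (series (fun n => complex.Re (u n)) n)%:C +
                           'i * (series (fun n => complex.Im (u n)) n)%:C).
  apply/funext => n; rewrite /series /= !rmorph_sum mulr_sumr -big_split /=.
  by apply: eq_bigr => i _; exact: complexE.
apply: (@cvgD (R[i] : numFieldType)); first exact: cvg_real_complex cRe.
by apply: cvgMl_tmp; exact: cvg_real_complex cIm.
Qed.

Lemma euler_term_real_complex (R : realType) (c q : R) n :
  euler_term c%:C q%:C n = (euler_term c q n)%:C.
Proof.
rewrite /euler_term /qpoch rmorphM fmorphV rmorphM !rmorphXn rmorphN rmorph_prod.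
by congr (_ / _); apply: eq_bigr => i _; rewrite rmorphB rmorph1 rmorphM rmorphXn.
Qed.

Lemma is_cvg_euler_complex (R : realType) (q : R) (c : R[i]) : 0 < q -> q < 1 ->
  cvgn (series (euler_term (c : (R[i] : numFieldType)) q%:C)).
Proof.
move=> q0 q1; have [q0C q1C] : 0 < q%:C /\ q%:C < 1 by rewrite !ltcR.
have cR : `|c| = (complex.Re `|c|)%:C by rewrite RRe_real // normr_real.
apply: (@is_cvg_series_complex _ _ (euler_term (- complex.Re `|c|) q)).
  by move=> n; rewrite norm_euler_term// cR -euler_term_real_complex rmorphN.
by apply: is_cvg_euler_real => //; rewrite -ler0c -cR.
Qed.

(* The ascription to numFieldType selects the topology of R[i] induced by the
   complex modulus. *)
Theorem mainTheorem7 (R : realType) (q : R) (x t : R[i]) :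
  0 < q -> q < 1 ->
  series (fun n : nat =>
      q%:C ^+ 'C(n, 2) * t ^+ n * stieltjes_wigert n (x * q%:C ^- n) q%:C)
    @ \oo --> (qpoch_inf2 (x * t) (- t) q%:C : (R[i] : numFieldType)).
Proof.
move=> q0 q1; have [q0C q1C] : 0 < q%:C /\ q%:C < 1 by rewrite !ltcR.
have qn0 : (fun n => q%:C ^+ n) @ \oo --> (0 : (R[i] : numFieldType)).
  have : (fun n => q ^+ n) @ \oo --> (0 : R) by apply: cvg_expr; rewrite gtr0_norm.
  by move=> /cvg_real_complex; under eq_fun do rewrite rmorphXn.
have cv c := @is_cvg_euler_complex R q c q0 q1.
exact: (@generating_function_of_summable (R[i] : numFieldType) x t q%:C q0C q1C qn0 cv).
Qed.
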